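(* Let $L_1$ and $L_2$ be nontrivial finite transitive permutation groups. If one of $L_1$ or $L_2$ is not semiprimitive, then the multiset $[L_1,L_2]$ is not locally-restrictive.
   Context: All graphs are connected, simple and locally finite. For a graph $\Gamma$, a vertex $v$ and a group $G$ of automorphisms of $\Gamma$, $\Gamma(v)$ is the neighbourhood of $v$, $G_v$ the stabiliser of $v$, $G_{uv}$ the stabiliser of both $u$ and $v$, and $G_v^{\Gamma(v)}$ the permutation group induced by $G_v$ on $\Gamma(v)$. $\Gamma$ is $G$-locally-transitive if $G_v^{\Gamma(v)}$ is transitive for every vertex $v$. For finite transitive permutation groups $L_1,L_2$, $(\Gamma,G)$ is locally $[L_1,L_2]$ if $\Gamma$ is $G$-locally-transitive and for some edge $\{u,v\}$ there are permutation isomorphisms $G_u^{\Gamma(u)}\cong L_1$ and $G_v^{\Gamma(v)}\cong L_2$. The multiset $[L_1,L_2]$ is locally-restrictive if there is a constant $c$ such that whenever $\Gamma$ is a finite $G$-locally-transitive graph with $(\Gamma,G)$ locally $[L_1,L_2]$ and $\{u,v\}$ is an edge of $\Gamma$, we have $|G_{uv}|\le c$. A permutation group is semiregular if only the identity fixes a point, and semiprimitive if each of its normal subgroups is either transitive or semiregular. *)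

(* Defs.v *)
From HB Require Import structures.
From mathcomp Require Import all_boot all_fingroup.

Set Implicit Arguments.
Unset Strict Implicit.
Unset Printing Implicit Defensive.

Local Open Scope group_scope.

Definition ptransitive (T : finType) (L : {set {perm T}}) : bool :=
  [transitive L, on [set: T] | 'P].

(* Not the [semiregular] of mathcomp's frobenius, which is about conjugation. *)
Definition psemiregular (T : finType) (L : {set {perm T}}) : Prop :=
  forall (g : {perm T}) (x : T), g \in L -> g x = x -> g = 1.

Definition semiprimitive (T : finType) (L : {group {perm T}}) : Prop :=
  forall N : {group {perm T}}, N <| L -> ptransitive N \/ psemiregular N.

Definition perm_isomorphic (T U : finType)
    (L : {group {perm T}}) (M : {group {perm U}}) : Prop :=
  exists (f : T -> U) (phi : {morphism L >-> {perm U}}),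
    [/\ bijective f, isom L M phi
      & forall g x, g \in L -> f (g x) = phi g (f x)].

Record graph := Graph {
  vertex :> finType;
  adj : rel vertex;
  adj_sym : symmetric adj;
  adj_irr : irreflexive adj;
  adj_connected : forall x y : vertex, connect adj x y }.

Section LocalAction.

Variable Gamma : graph.
Implicit Types (u v : Gamma) (G : {group {perm Gamma}}).

Definition nbhd v : {set Gamma} := [set w | adj v w].

Definition graph_aut : {set {perm Gamma}} :=
  [set g : {perm Gamma} | [forall x, forall y, adj (g x) (g y) == adj x y]].

(* The domain of the action ['P^?] on the subtype is the setwise stabiliser of
   [nbhd v], which contains ['C_G[v | 'P]] as soon as [G \subset graph_aut]. *)
Definition local_group G v : {group {perm {w : Gamma | w \in nbhd v}}} :=
  (actperm ('P^?) @* 'C_G[v | 'P])%G.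

Definition locally_transitive G : Prop :=
  forall v, ptransitive (local_group G v).

Definition locally (T1 T2 : finType) G
    (L1 : {group {perm T1}}) (L2 : {group {perm T2}}) : Prop :=
  locally_transitive G /\
  exists u v, [/\ adj u v, perm_isomorphic (local_group G u) L1
                & perm_isomorphic (local_group G v) L2].

End LocalAction.

(* ['C_G([set u; v] | 'P)] is the pointwise stabiliser of [u] and [v] in [G]. *)
Definition locally_restrictive (T1 T2 : finType)
    (L1 : {group {perm T1}}) (L2 : {group {perm T2}}) : Prop :=
  exists c : nat, forall (Gamma : graph) (G : {group {perm Gamma}}),
    G \subset graph_aut Gamma -> locally G L1 L2 ->
    forall u v : Gamma, adj u v -> (#|'C_G([set u; v] | 'P)| <= c)%N.

(* Main.v *)
Require Import Defs.
From HB Require Import structures.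
From mathcomp Require Import all_boot all_fingroup.

(* Let N be a normal subgroup of L1 that is neither transitive nor semiregular,
   fix w in T1 with a nontrivial stabiliser N_w, and w' in T2.  It suffices to
   find, inside some finite group, subgroups P1 and P2 such that P1 acts on
   P1 / (P1 :&: P2) as L1, P2 acts on P2 / (P1 :&: P2) as L2, no nontrivial
   subgroup of P1 :&: P2 is normal in <P1, P2>, and P1 :&: P2 is arbitrarily
   large: the coset graph of (P1, P2) then has the required local actions.

   Let D be a transversal of the N-orbits on T1 containing w, on which L1 acts
   through L1 / N.  Let M consist of the permutations
     (u, t) |-> (u', g_u t)   of   (option (D * T2 * {0, ..., n})) * T1
   where the g_u in L1 all lie in one coset of N, None' = None and
   (d, b, i)' = (g_u d, l b, i) for some l in L2, with g_u d in D.  In M the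
   subgroups U1 : l w' = w' and U2 : g_None w = w induce L1 and L2 through
   g_None and l, and their intersection B contains a copy of N_w for each
   fibre over (w, w', i), hence is large.  The shift e of fibres
     None -> (w, w', 0) -> ... -> (w, w', n) -> None
   normalises B, and P1 := U1 :^ e^-1 and P2 := U2 meet in B.  A subgroup
   of B normal in <P1, P2> is trivial on the fibre that e sends to None, and
   then on every fibre, since <P1, P2> permutes the fibres transitively; this
   uses e to change the level i, and D <> {w}. *)

Set Implicit Arguments.
Unset Strict Implicit.
Unset Printing Implicit Defensive.

Local Open Scope group_scope.

(** * Local actions *)

Lemma inj_surj_bij (T U : finType) (f : T -> U) :
  injective f -> (forall y, exists x, f x = y) -> bijective f.
Proof.
move=> f_inj f_surj; apply: inj_card_bij => //.
rewrite -(card_codom f_inj) subset_leq_card //.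
by apply/subsetP=> y _; have [x <-] := f_surj y; apply: codom_f.
Qed.

(** Conjugation by [f] is the isomorphism, so matching elements of the two groups one at a time
    suffices. *)
Lemma perm_isomorphicI (T U : finType) (f : T -> U)
    (L : {group {perm T}}) (M : {group {perm U}}) :
    bijective f ->
    (forall g, g \in L -> exists2 h, h \in M & forall x, f (g x) = h (f x)) ->
    (forall h, h \in M -> exists2 g, g \in L & forall x, f (g x) = h (f x)) ->
  perm_isomorphic L M.
Proof.
move=> f_bij LM ML; have [f' fK f'K] := f_bij.
have cj_inj (g : {perm T}) : injective (f \o g \o f').
  apply: inj_comp (can_inj f'K); apply: inj_comp (bij_inj f_bij) _.
  exact: perm_inj.
pose cj g := perm (cj_inj g).
have cjE g x : cj g (f x) = f (g x) by rewrite permE /= fK.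
have cjM : {in L &, {morph cj : x y / x * y}}.
  by move=> x y _ _; apply/permP=> z; rewrite -[z]f'K permM !cjE permM.
exists f, (Morphism cjM); split=> //.
apply/isomP; split.
  apply/injmP=> g h _ _ /= gh; apply/permP=> x.
  by apply: (can_inj fK); rewrite -!cjE gh.
apply/setP=> h; apply/morphimP/idP => [[g _ gL ->] | /ML[g gL gh]].
  have [h' h'M gh'] := LM g gL; suff -> : Morphism cjM g = h' by [].
  by apply/permP=> z; rewrite -[z]f'K /= cjE gh'.
by exists g => //; apply/permP=> z; rewrite -[z]f'K /= cjE gh.
Qed.

Lemma stab_nbhd_dom (Gamma : graph) (v : Gamma) (x : {perm Gamma}) :
  x \in graph_aut Gamma -> x v = v -> x \in subact_dom (mem (nbhd v)) 'P.
Proof.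
rewrite inE => /forallP autx xv; apply/astabsP=> w; rewrite !inE /= apermE.
by have /forallP/(_ w)/eqP := autx v; rewrite xv.
Qed.

Lemma mem_local_group (Gamma : graph) (G : {group {perm Gamma}}) (v : Gamma)
    (x : {perm Gamma}) :
    G \subset graph_aut Gamma -> x \in G -> x v = v ->
  exists2 y, y \in local_group G v & forall w, val (y w) = x (val w).
Proof.
move=> autG xG xv; have xdom := stab_nbhd_dom (subsetP autG x xG) xv.
exists (actperm ('P^?) x); last by move=> w; rewrite actpermE val_subact xdom.
by apply: mem_morphim => //; apply/setIP; split=> //; apply/astab1P.
Qed.

Lemma local_groupP (Gamma : graph) (G : {group {perm Gamma}}) (v : Gamma)
    (y : {perm {w : Gamma | w \in nbhd v}}) :
    G \subset graph_aut Gamma -> y \in local_group G v ->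
  exists x, [/\ x \in G, x v = v & forall w, val (y w) = x (val w)].
Proof.
move=> autG /morphimP[x xdom /setIP[xG /astab1P xv] ->].
by exists x; split=> // w; rewrite actpermE val_subact xdom.
Qed.

(** * Coset graphs *)

Section CosetGraph.

(** For transitive [L], this makes [L] on [T] the action of [H] on the cosets of [H :&: B]. A
    function constrained only on [H] replaces a morphism. *)
Definition stab_rep (gT : finGroupType) (H B : {group gT}) (T : finType)
    (L : {group {perm T}}) (phi : gT -> {perm T}) (a : T) : Prop :=
  [/\ forall x, x \in H -> phi x \in L,
      {in H &, {morph phi : x y / x * y}},
      forall g, g \in L -> exists2 x, x \in H & phi x = g
    & forall x, x \in H -> (phi x a == a) = (x \in B)].

Variables (gT : finGroupType) (P : bool -> {group gT}).

Let G := P true <*> P false.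

Let PG b : P b \subset G.
Proof. by case: b; rewrite ?joing_subl ?joing_subr. Qed.

(** The boolean separates the two sides even if some coset of [P true] is also one of [P false]. *)
Let bcoset_act (v : bool * {set gT}) (x : gT) := (v.1, v.2 :* x).

Let bcoset_is_action : is_action [set: gT] bcoset_act.
Proof.
apply: is_total_action => [[b A] | [b A] x y];
  rewrite /bcoset_act /= ?rcoset1 //.
by rewrite rcosetM.
Qed.

Let bcoset_action := Action bcoset_is_action.

Let is_vertex (v : bool * {set gT}) := v.2 \in rcosets (P v.1) G.

Let V := {v : bool * {set gT} | is_vertex v}.

Let is_vertex_coset b x : x \in G -> is_vertex (b, P b :* x).
Proof. by move=> xG; rewrite /is_vertex /= mem_rcosets mulSGid. Qed.

Let default_vertex : V := exist is_vertex _ (is_vertex_coset true (group1 G)).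

Let vtx b x : V := insubd default_vertex (b, P b :* x).

Let val_vtx b x : x \in G -> val (vtx b x) = (b, P b :* x).
Proof. by move=> xG; rewrite insubdK //; apply: is_vertex_coset. Qed.

Let eq_vtx b x y : x \in G -> y \in P b :* x -> vtx b x = vtx b y.
Proof. by move=> xG /rcoset_eqP eqxy; rewrite /vtx eqxy. Qed.

Let mem_vtx b c x y : x \in G -> y \in G -> vtx b x = vtx c y -> y \in P b :* x.
Proof.
move=> xG yG /(congr1 val); rewrite !val_vtx // => -[-> ->].
exact: rcoset_refl.
Qed.

Let vtxP v : exists b, exists2 x, x \in G & v = vtx b x.
Proof.
case: v => [[b A] vA]; have /rcosetsP[x xG AE] := vA.
by exists b, x => //; apply: val_inj; rewrite val_vtx //= -AE.
Qed.

Let vadj (v w : V) :=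
  ((val v).1 != (val w).1) && ((val v).2 :&: (val w).2 != set0).

Let vadj_sym : symmetric vadj.
Proof. by move=> v w; rewrite /vadj eq_sym setIC. Qed.

Let vadj_irr : irreflexive vadj.
Proof. by move=> v; rewrite /vadj eqxx. Qed.

Let vadj_vtx b x : x \in G -> vadj (vtx b x) (vtx (~~ b) x).
Proof.
move=> xG; rewrite /vadj !val_vtx //=; apply/andP; split; first by case: b.
by apply/set0Pn; exists x; rewrite inE !rcoset_refl.
Qed.

(** An element common to two cosets represents both, so every edge is a [G]-translate of the base
    edge. *)
Let vadjP v w :
  vadj v w -> exists b, exists2 x, x \in G & v = vtx b x /\ w = vtx (~~ b) x.
Proof.
have [b [x xG ->]] := vtxP v; have [c [y yG ->]] := vtxP w.
rewrite /vadj !val_vtx //= => /andP[neq_bc /set0Pn[z /setIP[zx zy]]].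
have zG : z \in G.
  by case/rcosetP: zx => a aP ->; rewrite groupM // (subsetP (PG b)).
exists b, z => //; rewrite (eq_vtx xG zx) (eq_vtx yG zy); split=> //.
by case: b c neq_bc {zx zy} => [] [].
Qed.

(** * The action of [G] on the coset graph *)

Let G_dom : G \subset subact_dom is_vertex bcoset_action.
Proof.
apply/subsetP=> x xG; apply/astabsP=> -[b A].
rewrite !inE /= /is_vertex /=; apply/rcosetsP/rcosetsP=> -[y yG AE].
  exists (y * x^-1); first by rewrite groupM ?groupV.
  by rewrite rcosetM -AE -rcosetM mulgV rcoset1.
by exists (y * x); rewrite ?groupM // rcosetM AE.
Qed.

Let rho : gT -> {perm V} := actperm (bcoset_action^?).

Let rhoE b x y : x \in G -> y \in G -> rho x (vtx b y) = vtx b (y * x).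
Proof.
move=> xG yG; apply: val_inj; rewrite /rho actpermE val_subact.
by rewrite (subsetP G_dom) // !val_vtx ?groupM //= /bcoset_act /= rcosetM.
Qed.

Let vadj_rho x v w : x \in G -> vadj (rho x v) (rho x w) = vadj v w.
Proof.
have imp y v' w' : y \in G -> vadj v' w' -> vadj (rho y v') (rho y w').
  move=> yG /vadjP[b [z zG [-> ->]]].
  by rewrite !rhoE // vadj_vtx // groupM.
move=> xG; apply/idP/idP; last exact: imp.
move/(imp x^-1); rewrite groupV => /(_ xG).
have [b [y yG ->]] := vtxP v; have [c [z zG ->]] := vtxP w.
by rewrite !rhoE ?groupM ?groupV // !mulgK.
Qed.

Let connect_rho x v w :
  x \in G -> connect vadj v w -> connect vadj (rho x v) (rho x w).
Proof.
move=> xG /connectP[p vp ->]; apply/connectP.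
exists (map (rho x) p); last by rewrite last_map.
by rewrite path_map; apply: sub_path vp => ? ? /=; rewrite vadj_rho.
Qed.

Let vconnected v w : connect vadj v w.
Proof.
suff con u : connect vadj (vtx true 1) u.
  apply: connect_trans (con w); rewrite (sym_connect_sym vadj_sym).
  exact: con.
have step b : connect vadj (vtx b 1) (vtx (~~ b) 1).
  by apply: connect1; apply: vadj_vtx.
(* This set is a subgroup containing [P true] and [P false], hence all of [G]. *)
pose H := [set x in G | connect vadj (vtx true 1) (vtx true x)].
have gH : group_set H.
  apply/group_setP; split=> [|x y]; first by rewrite inE group1 connect0.
  rewrite !inE => /andP[xG xH] /andP[yG yH]; rewrite groupM //=.
  apply: connect_trans yH _; have := connect_rho yG xH.
  by rewrite !rhoE // mul1g.
have GH : G \subset H.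
  rewrite -[H]/(gval (Group gH)) join_subG; apply/andP.
  split; apply/subsetP=> x xP.
    rewrite inE (subsetP (PG true)) //=.
    rewrite (eq_vtx (group1 _) (y := x)) ?connect0 //.
    by rewrite rcoset1.
  have xG := subsetP (PG false) x xP.
  rewrite inE xG /=; apply: connect_trans (step true) _.
  rewrite (eq_vtx (group1 _) (y := x)) ?rcoset1 //=.
  by apply: connect1; apply: (vadj_vtx false).
have [b [x xG ->]] := vtxP u.
have : connect vadj (vtx true 1) (vtx true x).
  by have := subsetP GH x xG; rewrite inE xG.
case: b => // con; apply: connect_trans con _.
by apply: connect1; apply: (vadj_vtx true).
Qed.

Let Gamma := Graph vadj_sym vadj_irr vconnected.

Let rhoG : {group {perm Gamma}} := (actperm (bcoset_action^?) @* G)%G.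

Let rhoGP y : reflect (exists2 x, x \in G & y = rho x) (y \in rhoG).
Proof.
apply: (iffP morphimP) => [[x _ xG ->] | [x xG ->]]; first by exists x.
by exists x => //; apply: subsetP G_dom x xG.
Qed.

Let rhoG_aut : rhoG \subset graph_aut Gamma.
Proof.
apply/subsetP=> _ /rhoGP[x xG ->]; rewrite inE.
by apply/forallP=> v; apply/forallP=> w; apply/eqP/vadj_rho.
Qed.

Let rhoG_locally_transitive : locally_transitive rhoG.
Proof.
have nbr v w : vadj v w -> forall w', vadj v w' ->
    exists2 x, x \in G & rho x v = v /\ rho x w = w'.
  case/vadjP=> b [x xG [-> ->]] w' /vadjP[c [y yG [eq_xy ->]]].
  (* Both edges are translates of a base edge, by [x] and by [y]. *)
  exists (x^-1 * y); first by rewrite groupM ?groupV.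
  have bc : b = c by have /(congr1 val) := eq_xy; rewrite !val_vtx // => -[].
  by rewrite !rhoE ?groupM ?groupV // !mulKVg eq_xy bc.
move=> v; have [b [x xG vE]] := vtxP v.
have w0P : vtx (~~ b) x \in nbhd (v : Gamma) by rewrite inE vE; apply: vadj_vtx.
apply/imsetP; exists (exist (fun w => w \in nbhd (v : Gamma)) _ w0P) => //.
apply/eqP; rewrite eq_sym eqEsubset subsetT; apply/subsetP=> -[w wv] _.
have [y yG [yv yw]] :
    exists2 y, y \in G & rho y v = v /\ rho y (vtx (~~ b) x) = w.
  by apply: nbr; [move: w0P | move: wv]; rewrite inE.
have [z zL zE] : exists2 z, z \in local_group rhoG (v : Gamma) &
    forall w, val (z w) = rho y (val w).
  by apply: mem_local_group => //; apply/rhoGP; exists y.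
by apply/imsetP; exists z => //; apply: val_inj; rewrite /= apermE zE.
Qed.

(** Neighbours of the base vertex are the cosets [P (~~ b) :* x] with [x] in [P b]; sending such a
    coset to [phi x a] is well defined and injective because [a] has stabiliser [P b :&: P (~~ b)]
    in [P b]. *)
Let rhoG_local (T : finType) (L : {group {perm T}}) phi a b :
    stab_rep (P b) (P (~~ b)) L phi a -> ptransitive L ->
  perm_isomorphic (local_group rhoG (vtx b 1)) L.
Proof.
case=> phiL phiM Lphi stab trL.
have PGx x : x \in P b -> x \in G by apply: subsetP (PG b) x.
have phi1 : phi 1 = 1 by apply: (mulgI (phi 1)); rewrite -phiM // !mulg1.
have phiV x : x \in P b -> phi x^-1 = (phi x)^-1.
  by move=> xP; apply: (mulgI (phi x)); rewrite -phiM ?groupV // !mulgV.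
have nbrP (w : V) : reflect (exists2 x, x \in P b & w = vtx (~~ b) x)
    (w \in nbhd (vtx b 1 : Gamma)).
  rewrite inE; apply: (iffP idP) => [/vadjP[c [x xG [eq_1x ->]]] | [x xP ->]].
    have bc : b = c by have /(congr1 val) := eq_1x; rewrite !val_vtx // => -[].
    rewrite -bc; exists x => //.
    by have := mem_vtx (group1 G) xG eq_1x; rewrite rcoset1.
  rewrite (eq_vtx (group1 _) (y := x)) ?rcoset1 //.
  by apply: vadj_vtx; apply: PGx.
pose pos (w : V) := phi (repr (P b :&: (val w).2)) a.
have posE x : x \in P b -> pos (vtx (~~ b) x) = phi x a.
  move=> xP; rewrite /pos val_vtx ?PGx //=.
  have /mem_repr : x \in P b :&: (P (~~ b) :* x) by rewrite inE xP rcoset_refl.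
  move: (repr _) => z /setIP[zP]; rewrite mem_rcoset => zx.
  have zxP : z * x^-1 \in P b by rewrite groupM ?groupV.
  move: zx; rewrite -stab // => /eqP zxa.
  by rewrite -[z](mulgKV x) phiM // permM zxa.
pose f (w : {w : Gamma | w \in nbhd (vtx b 1 : Gamma)}) := pos (val w).
have f_bij : bijective f.
  apply: inj_surj_bij => [[w wP] [w' w'P] | t].
    have [x xP wE] := nbrP _ wP; have [y yP w'E] := nbrP _ w'P.
    rewrite /f /= => eq_pos; apply: val_inj; move: eq_pos.
    rewrite /= wE w'E !posE // => eq_xy; apply: eq_vtx; first exact: PGx.
    rewrite mem_rcoset -stab ?groupM ?groupV //.
    by rewrite phiM ?groupV // phiV // permM -eq_xy permK.
  have [g gL tE] := atransP2 trL (in_setT a) (in_setT t).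
  have [x xP gE] := Lphi g gL.
  have wP : vtx (~~ b) x \in nbhd (vtx b 1 : Gamma) by apply/nbrP; exists x.
  exists (exist (fun w => w \in nbhd (vtx b 1 : Gamma)) _ wP).
  by rewrite /f /= posE // gE tE.
have rhoP x : x \in P b -> rho x (vtx b 1) = vtx b 1.
  move=> xP; rewrite rhoE ?PGx // mul1g; apply/esym/eq_vtx; first exact: group1.
  by rewrite rcoset1.
have f_rho x w w' : x \in P b -> val w' = rho x (val w) -> f w' = phi x (f w).
  move=> xP; rewrite /f => ->; case: w => w wP /=; have [y yP ->] := nbrP w wP.
  by rewrite rhoE ?PGx // !posE ?groupM // phiM // permM.
apply: (perm_isomorphicI f_bij) => [y | g gL].
  case/(local_groupP rhoG_aut)=> _ [/rhoGP[x xG ->] xv yE].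
  have xP : x \in P b.
    move: xv; rewrite rhoE // mul1g => /esym/(mem_vtx (group1 G) xG).
    by rewrite rcoset1.
  by exists (phi x); [apply: phiL | move=> w; apply: f_rho (yE w)].
have [x xP gE] := Lphi g gL.
have [y yL yE] : exists2 y, y \in local_group rhoG (vtx b 1 : Gamma) &
    forall w, val (y w) = rho x (val w).
  apply: mem_local_group; [by [] | | exact: rhoP].
  by apply/rhoGP; exists x; first exact: PGx.
by exists y => // w; rewrite -gE; apply: f_rho (yE w).
Qed.

(** The hypothesis on [K] makes the action faithful: its kernel fixes both ends of the base edge.
    Hence [P true :&: P false] embeds in the stabiliser of these two ends. *)
Lemma coset_graph (T1 T2 : finType)
    (L1 : {group {perm T1}}) (L2 : {group {perm T2}}) phi1 phi2 a1 a2 :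
    ptransitive L1 -> ptransitive L2 ->
    stab_rep (P true) (P false) L1 phi1 a1 ->
    stab_rep (P false) (P true) L2 phi2 a2 ->
    (forall K : {group gT},
      K <| G -> K \subset P true :&: P false -> K :=: 1) ->
  exists (Gamma : graph) (H : {group {perm Gamma}}) (u v : Gamma),
    [/\ H \subset graph_aut Gamma, locally H L1 L2, adj u v
      & (#|P true :&: P false| <= #|'C_H([set u; v] | 'P)|)%N].
Proof.
move=> trL1 trL2 rep1 rep2 core.
have PGx b x : x \in P b -> x \in G by apply: subsetP (PG b) x.
have adj1 : vadj (vtx true 1) (vtx false 1) by apply: (@vadj_vtx true).
exists Gamma, rhoG, (vtx true 1), (vtx false 1); split=> //.
  split; first exact: rhoG_locally_transitive.
  exists (vtx true 1), (vtx false 1); split=> //.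
    exact: (@rhoG_local _ _ _ _ true rep1).
  exact: (@rhoG_local _ _ _ _ false rep2).
have rho_stab b x : x \in G -> rho x (vtx b 1) = vtx b 1 -> x \in P b.
  move=> xG; rewrite rhoE // mul1g => /esym/(mem_vtx (group1 G) xG).
  by rewrite rcoset1.
have rho_fix b x : x \in P b -> rho x (vtx b 1) = vtx b 1.
  move=> xP; rewrite rhoE ?(PGx b) // mul1g.
  apply/esym/eq_vtx; first exact: group1.
  by rewrite rcoset1.
have rho_inj : {in G &, injective rho}.
  pose K : {group gT} :=
    (G :&: 'ker (actperm (bcoset_action^?) : _ -> {perm V}))%G.
  have K1 : K :=: 1.
    apply: core; first by apply: normalGI G_dom (ker_normal _).
    apply/subsetP=> x /setIP[xG /mker rho1].
    by rewrite inE !rho_stab // /rho rho1 perm1.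
  move=> x y xG yG eq_xy; apply/eqP; rewrite eq_mulgV1 -in_set1 -[[set 1]]K1.
  have Gdom z : z \in G -> z \in subact_dom is_vertex bcoset_action.
    exact: subsetP G_dom z.
  rewrite inE groupM ?groupV //=; apply/kerP; rewrite ?groupM ?groupV ?Gdom //.
  rewrite morphM ?morphV ?groupV ?Gdom //.
  by have : rho x * (rho y)^-1 = 1 by rewrite eq_xy mulgV.
rewrite -(card_in_imset (f := rho)); last first.
  by move=> x y /setIP[xP _] /setIP[yP _]; apply: rho_inj; apply: (PGx true).
apply: subset_leq_card; apply/subsetP=> _ /imsetP[x /setIP[xPt xPf] ->].
apply/setIP; split; first by apply/rhoGP; exists x => //; apply: (PGx true).
by apply/astabP=> v; rewrite !inE => /orP[] /eqP->; apply: rho_fix.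
Qed.

End CosetGraph.

(** * Construction of the amalgam *)

Section TwistedAmalgam.

Variables (T1 T2 D : finType).
Variables (L1 N : {group {perm T1}}) (L2 : {group {perm T2}}).
(** [D] indexes the [N]-orbits, [blk] sends a point to its orbit and [rep] picks a base point in
    each. *)
Variables (rep : D -> T1) (blk : T1 -> D) (d0 d1 : D) (b0 b1 : T2) (n : nat).

Hypothesis nN : N <| L1.
Hypothesis repK : cancel rep blk.
Hypothesis blkP : forall s t, (blk s == blk t) = (s \in orbit 'P N t).
Hypothesis neq_d : d1 != d0.
Hypothesis neq_b : b1 != b0.
Hypothesis trL1 : ptransitive L1.
Hypothesis trL2 : ptransitive L2.

(* [a0] and [b0] are the points w and w' of the header. *)
Let a0 := rep d0.
Let cell := option (D * T2 * 'I_n.+1).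
Let point := (cell * T1)%type.

Let shift (r : {perm T1}) (l : {perm T2}) (u : cell) : cell :=
  omap (fun c => (blk (r (rep c.1.1)), l c.1.2, c.2)) u.

(** [H1] and [H2] are parameters so that one definition yields [U1], [U2] and [B]. The last clause
    sends base points to base points; with it [B] fixes the base point of every spine fibre, as it
    does over [None]. *)
Let data (H1 : {set {perm T1}}) (H2 : {set {perm T2}})
    (g : cell -> {perm T1}) (l : {perm T2}) : bool :=
  [&& g None \in H1, l \in H2, [forall u, g u \in N :* g None]
    & [forall c : D * T2 * 'I_n.+1,
        g (Some c) (rep c.1.1) == rep (blk (g None (rep c.1.1)))]].

Let induces (x : {perm point}) (g : cell -> {perm T1}) (l : {perm T2}) :=
  forall u t, x (u, t) = (shift (g None) l u, g u t).

Let M (H1 : {set {perm T1}}) (H2 : {set {perm T2}}) : {set {perm point}} :=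
  [set x : {perm point} | [exists g : {ffun cell -> {perm T1}},
    [exists l, data H1 H2 g l &&
      [forall z, x z == (shift (g None) l z.1, g z.1 z.2)]]]].

Let dataP (H1 : {set {perm T1}}) (H2 : {set {perm T2}})
    (g : cell -> {perm T1}) l :
  reflect
    [/\ g None \in H1, l \in H2, forall u, g u \in N :* g None
      & forall d b i, g (Some (d, b, i)) (rep d) = rep (blk (g None (rep d)))]
    (data H1 H2 g l).
Proof.
apply: (iffP and4P) => [[g0 lH /forallP gN /forallP gc] | [g0 lH gN gc]].
  by split=> // d b i; apply/eqP; apply: (gc (d, b, i)).
by split=> //; [apply/forallP | apply/forallP=> -[[d b] i] /=; rewrite gc].
Qed.

Let MP H1 H2 x :
  reflect (exists g l, data H1 H2 g l /\ induces x g l) (x \in M H1 H2).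
Proof.
rewrite inE; apply: (iffP existsP) => [[g] | [g [l [gl xE]]]].
  case/existsP=> l /andP[gl /forallP xE].
  by exists g, l; split=> // u t; apply/eqP; apply: (xE (u, t)).
have fE u : [ffun u => g u] u = g u by rewrite ffunE.
exists [ffun u => g u]; apply/existsP; exists l; apply/andP; split.
  case/dataP: gl => g0 lH gN gc; apply/dataP.
  by split=> [||u|d b i]; rewrite ?fE.
by apply/forallP=> -[u t]; rewrite !fE xE.
Qed.

Let N_sub r s : s \in L1 -> r \in N :* s -> r \in L1.
Proof.
move=> sL /rcosetP[m mN ->]; rewrite groupM //.
exact: subsetP (normal_sub nN) m mN.
Qed.

(** [L1] permutes the orbits of its normal subgroup [N], and [N] fixes each of them. *)
Let blk_coset r r' t : r' \in N :* r -> r \in L1 -> blk (r' t) = blk (r t).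
Proof.
case/rcosetP=> m mN -> rL; rewrite permM; apply/eqP; rewrite blkP.
apply/orbitP; exists (m ^ r).
  by rewrite memJ_norm // (subsetP (normal_norm nN)).
by rewrite /= apermE /conjg !permM permK.
Qed.

Let blk_rep r t : r \in L1 -> blk (r (rep (blk t))) = blk (r t).
Proof.
move=> rL; have : rep (blk t) \in orbit 'P N t by rewrite -blkP repK.
case/orbitP=> m mN /= <-; rewrite apermE -permM; apply: blk_coset => //.
by rewrite mem_rcoset mulgK.
Qed.

Let shift_coset r r' l u :
  r' \in N :* r -> r \in L1 -> shift r' l u = shift r l u.
Proof.
by move=> r'N rL; case: u => [[[d b] i]|] //=; rewrite (blk_coset _ r'N).
Qed.

Let shiftM r r' l l' u : r' \in L1 ->
  shift r' l' (shift r l u) = shift (r * r') (l * l') u.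
Proof.
by move=> r'L; case: u => [[[d b] i]|] //=; rewrite blk_rep // !permM.
Qed.

Let shift1 u : shift 1 1 u = u.
Proof. by case: u => [[[d b] i]|] //=; rewrite !perm1 repK. Qed.

Let shift_inj r l : r \in L1 -> injective (shift r l).
Proof.
move=> rL; apply: (can_inj (g := shift r^-1 l^-1)) => u.
by rewrite shiftM ?groupV // !mulgV shift1.
Qed.

Let M_ex (H1 : {group {perm T1}}) (H2 : {set {perm T2}}) g l :
  H1 \subset L1 -> data H1 H2 g l -> exists2 x, x \in M H1 H2 & induces x g l.
Proof.
move=> sH1 gl; have /dataP[/(subsetP sH1) g0L _ _ _] := gl.
have f_inj : injective (fun z : point => (shift (g None) l z.1, g z.1 z.2)).
  move=> [u t] [v s] /= [/(shift_inj g0L) <- /perm_inj <-]; reflexivity.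
have fE : induces (perm f_inj) g l by move=> u t; rewrite permE.
by exists (perm f_inj) => //; apply/MP; exists g, l.
Qed.

Let M_group (H1 : {group {perm T1}}) (H2 : {group {perm T2}}) :
  H1 \subset L1 -> group_set (M H1 H2).
Proof.
move=> sH1; apply/group_setP; split=> [|x y].
  apply/MP; exists (fun=> 1), 1; split=> [|u t]; last by rewrite !perm1 shift1.
  apply/dataP; split=> // *; rewrite ?rcoset_refl //.
  by rewrite !perm1 repK.
case/MP=> g [l [/dataP[g0 lH gN gc] xE]] /MP[h [k [/dataP[h0 kH hN hc] yE]]].
have [g0L h0L] := (subsetP sH1 _ g0, subsetP sH1 _ h0).
apply/MP; exists (fun u => g u * h (shift (g None) l u)), (l * k).
split=> [|u t]; last first.
  by rewrite [LHS]permM xE yE [in RHS]permM /= shiftM.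
apply/dataP; split=> [||u|d b i] /=; rewrite ?groupM //.
  rewrite -rcoset_mul ?mem_mulg // (subsetP (normal_norm nN)) //.
by rewrite !permM gc hc blk_rep.
Qed.

(** * Rotating the spine *)

(* [insub] returns [None] on [n.+1], which closes the cycle. *)
Let next (o : option 'I_n.+1) : option 'I_n.+1 :=
  insub (if o is Some i then i.+1 else 0%N).

Let spine_pt (o : option 'I_n.+1) : cell := omap (fun i => (d0, b0, i)) o.
Let level (u : cell) : option 'I_n.+1 := omap (fun c => c.2) u.
Let spine (u : cell) := u == spine_pt (level u).

Let climb (u : cell) : cell := if spine u then spine_pt (next (level u)) else u.

Let spine_ptK : cancel spine_pt level.
Proof. by case. Qed.

Let spine_spine_pt o : spine (spine_pt o).
Proof. by rewrite /spine spine_ptK. Qed.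

Let next_inj : injective next.
Proof.
(* [k] codes [None] as 0 and [Some i] as [i.+1]; on codes, [next] adds one modulo [n.+2]. *)
pose k (o : option 'I_n.+1) := if o is Some i then i.+1 else 0%N.
have k_inj : injective k by move=> [i|] [j|] //= [/val_inj->].
have k_le o : (k o <= n.+1)%N by case: o => [i|] /=.
move=> o o' eq_next; apply: k_inj; move: eq_next (k_le o) (k_le o').
rewrite /next -/(k o) -/(k o').
case: insubP => [i _ <-|]; case: insubP => [j _ <-|] //; first by case=> ->.
rewrite -!leqNgt => ge' ge _ le le'; apply/eqP.
by rewrite eqn_leq (leq_trans le ge') (leq_trans le' ge).
Qed.

Let climb_spine u : spine (climb u) = spine u.
Proof.
by rewrite /climb; case: ifPn => [_|/negPf->//]; rewrite spine_spine_pt.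
Qed.

Let climb_off u : ~~ spine u -> climb u = u.
Proof. by rewrite /climb => /negPf->. Qed.

Let climb_inj : injective climb.
Proof.
move=> u v eq_uv; have := climb_spine u; rewrite eq_uv climb_spine => eq_sp.
move: eq_uv; rewrite /climb eq_sp; case: ifP => // su.
move/(can_inj spine_ptK)/next_inj.
by move: eq_sp; rewrite su => /eqP uE eq_lev; rewrite uE (eqP su) eq_lev.
Qed.

Let climb_None : climb None = Some (d0, b0, ord0).
Proof.
rewrite /climb /spine /next /=; case: insubP => //= i _ iE.
by congr (Some (_, _, _)); apply: val_inj.
Qed.

Let climb_Some (i j : 'I_n.+1) : j = i.+1 :> nat ->
  climb (Some (d0, b0, i)) = Some (d0, b0, j).
Proof.
move=> ji; rewrite /climb /spine /= eqxx /next.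
case: insubP => /= [k _ kE|]; last by rewrite -ji ltn_ord.
by congr (Some (_, _, _)); apply: val_inj; apply: etrans kE (esym ji).
Qed.

Let climb_max : climb (Some (d0, b0, ord_max)) = None.
Proof.
by rewrite /climb /spine /= eqxx /next; case: insubP; rewrite //= ltnn.
Qed.

Let climb_pt_inj : injective (fun z : point => (climb z.1, z.2)).
Proof. by move=> [u s] [v t] /= [/climb_inj-> ->]. Qed.

Let e := perm climb_pt_inj.

Let eE u t : e (u, t) = (climb u, t).
Proof. by rewrite permE. Qed.

(** * The groups [U1], [U2] and [B] *)

Let S1 := 'C_L1[a0 | 'P]%G.
Let S2 := 'C_L2[b0 | 'P]%G.

Let S1P r : (r \in S1) = (r \in L1) && (r a0 == a0).
Proof. by rewrite inE; congr (_ && _); apply/astab1P/eqP. Qed.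

Let S2P l : (l \in S2) = (l \in L2) && (l b0 == b0).
Proof. by rewrite inE; congr (_ && _); apply/astab1P/eqP. Qed.

Let sS1 : S1 \subset L1. Proof. exact: subsetIl. Qed.
Let sS2 : S2 \subset L2. Proof. exact: subsetIl. Qed.

Let U1 := Group (M_group S2 (subxx L1)).
Let U2 := Group (M_group L2 sS1).
Let B := Group (M_group S2 sS1).

Let M_sub (H1 K1 : {set {perm T1}}) (H2 K2 : {set {perm T2}}) :
  H1 \subset K1 -> H2 \subset K2 -> M H1 H2 \subset M K1 K2.
Proof.
move=> s1 s2; apply/subsetP=> x /MP[g [l [/dataP[g0 lH gN gc] xE]]].
apply/MP; exists g, l; split=> //; apply/dataP.
by split; rewrite ?(subsetP s1) ?(subsetP s2).
Qed.

(** Elements of [B] fix each spine cell and the point [a0] over it, so rotating the spine preserves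
    their description. Equal orders reduce the claim to one inclusion. *)
Let B_climb : B :^ e^-1 = B.
Proof.
apply/eqP; rewrite eqEcard cardJg leqnn andbT; apply/subsetP=> y.
rewrite mem_conjgV => /MP[g [l [/dataP[+ lS gN gc] xE]]].
rewrite S1P => /andP[g0L /eqP g0a]; move: lS; rewrite S2P => /andP[lL /eqP lb].
have gL u : g u \in L1 by apply: N_sub (gN u).
have ga b i : g (Some (d0, b, i)) a0 = a0 by rewrite gc g0a repK.
have fix_spine u : spine u -> shift (g None) l u = u.
  by case: u => [[[d b] i]|] // /eqP[-> ->]; rewrite /= g0a repK lb.
have shift_climb u : shift (g None) l (climb u) = climb (shift (g None) l u).
  have [su | nsu] := boolP (spine u).
    by rewrite !fix_spine // climb_spine.
  rewrite !climb_off //; apply: contra nsu => /[dup] /fix_spine.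
  by move/(shift_inj g0L)->.
have hN u : g u \in N :* g (climb None).
  by have /rcoset_eqP-> := gN (climb None).
(* Fibres are relabelled by [climb]: the new component at [None] is the old one at [(d0, b0, 0)],
   which also fixes [a0]. *)
apply/MP; exists (fun u => g (climb u)), l; split.
  apply/dataP; split=> [||u|d b i] //=.
  - by rewrite S1P gL climb_None ga eqxx.
  - by rewrite S2P lL lb eqxx.
  rewrite (blk_coset _ (gN (climb None))) //.
  have [/eqP[-> ->] | nsu] := boolP (spine (Some (d, b, i))); last first.
    by rewrite climb_off.
  rewrite /climb /spine /= eqxx -/a0 g0a repK.
  by case: (next _) => [j|] /=.
move=> u t; apply: (@perm_inj _ e); rewrite eE -(permJ y) eE xE shift_climb.
by rewrite (shift_coset _ _ (gN (climb None))).
Qed.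


(** [M] provides [g] and [l] only existentially; [phi1] and [phi2] read [g None] and [l] off the
    permutation. The default is never taken on [M]. *)
Let phi1 (x : {perm point}) : {perm T1} :=
  odflt 1 [pick r : {perm T1} | [forall t, x (None, t) == (None, r t)]].

Let phi1E x g l : induces x g l -> phi1 x = g None.
Proof.
move=> xE; rewrite /phi1; case: pickP => [r /forallP rE | /(_ (g None))/negP[]].
  by apply/permP=> t; have := rE t; rewrite xE => /eqP[].
by apply/forallP=> t; rewrite xE.
Qed.

Let phi2 (x : {perm point}) : {perm T2} :=
  odflt 1 [pick l : {perm T2} | [forall b,
    omap (fun c => c.1.2) (x (Some (d0, b, ord0), a0)).1 == Some (l b)]].

Let phi2E x g l : induces x g l -> phi2 x = l.
Proof.
move=> xE; rewrite /phi2; case: pickP => [k /forallP kE | /(_ l)/negP[]].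
  by apply/permP=> b; have := kE b; rewrite xE => /eqP[].
by apply/forallP=> b; rewrite xE.
Qed.

Let induces_mul x y g h l k :
    g None \in L1 -> h None \in L1 -> induces x g l -> induces y h k ->
  induces (x * y) (fun u => g u * h (shift (g None) l u)) (l * k).
Proof.
by move=> gL hL xE yE u t; rewrite [LHS]permM xE yE [in RHS]permM /= shiftM.
Qed.

(** * The amalgam and its core *)

Let P c : {group {perm point}} := if c then (U1 :^ e^-1)%G else U2.

Let P_cap : P true :&: P false = B.
Proof.
apply/eqP; rewrite eqEsubset; apply/andP; split; last first.
  rewrite subsetI; apply/andP; split; last exact: M_sub.
  by rewrite -B_climb conjSg; apply: M_sub.
apply/subsetP=> x /setIP[xU1 xU2]; move: xU1; rewrite mem_conjgV.
case/MP=> h [k [_ yE]]; case/MP: xU2 => g [l [/dataP[g0 lL gN gc] xE]].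
apply/MP; exists g, l; split=> //; apply/dataP; split=> //.
(* [e] maps the top fibre to the one over [None], which [U1] preserves; so [x] preserves the top
   fibre and [l] fixes [b0]. *)
pose top : cell := Some (d0, b0, ord_max).
have topE t : (None, t) = e (top, t) by rewrite eE climb_max.
have := yE None a0; rewrite /= [in LHS]topE [in RHS]topE permJ => /perm_inj.
by rewrite xE /= S2P lL => -[_ -> _]; rewrite eqxx.
Qed.

Let M_phi1 (H1 : {set {perm T1}}) (H2 : {set {perm T2}}) x :
  x \in M H1 H2 -> phi1 x \in H1.
Proof. by case/MP=> g [l [/dataP[gH _ _ _] /phi1E->]]. Qed.

Let M_phi2 (H1 : {set {perm T1}}) (H2 : {set {perm T2}}) x :
  x \in M H1 H2 -> phi2 x \in H2.
Proof. by case/MP=> g [l [/dataP[_ lH _ _] /phi2E->]]. Qed.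

Let phiM : {in M L1 L2 &, forall x y,
  phi1 (x * y) = phi1 x * phi1 y /\ phi2 (x * y) = phi2 x * phi2 y}.
Proof.
move=> x y /MP[g [l [/dataP[gL _ _ _] xE]]] /MP[h [k [/dataP[hL _ _ _] yE]]].
have xyE := induces_mul gL hL xE yE.
by rewrite !(phi1E xyE, phi1E xE, phi1E yE, phi2E xyE, phi2E xE, phi2E yE).
Qed.

Let lift_L2 (l : {perm T2}) : l \in L2 ->
  exists2 x, x \in U2 & induces x (fun=> 1) l.
Proof.
move=> lL; apply: M_ex => //; apply/dataP; split=> //.
- by move=> u; rewrite rcoset_refl.
by move=> d b i; rewrite !perm1 repK.
Qed.

Let lift_L1 (r : {perm T1}) : r \in L1 ->
  exists g, exists2 x, x \in U1 & induces x g 1 /\ g None = r.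
Proof.
move=> rL.
have ex_m s : exists2 m, m \in N & m s = rep (blk s).
  have /orbitP[m mN /= ms] : rep (blk s) \in orbit 'P N s by rewrite -blkP repK.
  by exists m.
pose cor s := odflt 1 [pick m in N | m s == rep (blk s)].
have corP s : cor s \in N /\ cor s s = rep (blk s).
  rewrite /cor; case: pickP => [m /andP[mN /eqP ms] // | no].
  by have [m mN ms] := ex_m s; have := no m; rewrite /= mN ms eqxx.
(* Off [None], an element of [N] corrects [r] so that base points go to base points. *)
pose g (u : cell) := if u is Some c then r * cor (r (rep c.1.1)) else r.
have gP : data L1 S2 g 1.
  apply/dataP; split=> // [[c|]|d b i] /=; last by rewrite permM (corP _).2.
    rewrite norm_rlcoset ?(subsetP (normal_norm nN)) // mem_lcoset mulKg.
    exact: (corP _).1.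
  by rewrite rcoset_refl.
by have [x xU xE] := M_ex (subxx L1) gP; exists g, x.
Qed.

Let core (K : {group {perm point}}) :
  K <| P true <*> P false -> K \subset P true :&: P false -> K :=: 1.
Proof.
set G := _ <*> _ => nK sK.
have PG c : P c \subset G by case: c; rewrite ?joing_subl ?joing_subr.
have nKG y : y \in G -> y \in 'N(K) by apply: subsetP (normal_norm nK) y.
pose fixed u := forall x t, x \in K -> x (u, t) = (u, t).
(* As [K] is normal, triviality on a fibre passes along any element of [G] carrying it to another
   fibre. *)
have fixed_move y (h : {perm T1}) u v :
    y \in G -> (forall t, y (u, t) = (v, h t)) -> fixed u -> fixed v.
  move=> yG yE fu x t xK; rewrite -[t](permKV h) -yE.
  have xyK : x ^ y^-1 \in K by rewrite memJ_norm // groupV nKG.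
  have := permJ (x ^ y^-1) y (u, h^-1 t).
  by rewrite conjgKV (fu (x ^ y^-1)) // => ->.
have move_b d b b' i : fixed (Some (d, b, i)) -> fixed (Some (d, b', i)).
  have [l lL ->] := atransP2 trL2 (in_setT b) (in_setT b').
  have [y yU yE] := lift_L2 lL; apply: (fixed_move y 1).
    exact: subsetP (PG false) y yU.
  by move=> t; rewrite yE /= !perm1 repK.
(* [P true] acts on cells as [U1] does once they are relabelled by [climb]. *)
have move_d d d' b i u v :
    climb u = Some (d, b, i) -> climb v = Some (d', b, i) -> fixed u -> fixed v.
  have [r rL rE] := atransP2 trL1 (in_setT (rep d)) (in_setT (rep d')).
  move=> uE vE; have [g [y yU [yE g0]]] := lift_L1 rL.
  apply: (fixed_move (y ^ e^-1) (g (climb u))).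
    by apply: subsetP (PG true) _ _; rewrite memJ_conjg.
  move=> t; apply: (@perm_inj _ e); rewrite -(permJ (y ^ e^-1)) conjgKV !eE yE.
  rewrite g0 uE vE /= perm1.
  by have /= := rE; rewrite apermE => <-; rewrite repK.
have climb_off_b d b i : b != b0 -> climb (Some (d, b, i)) = Some (d, b, i).
  by move=> nb; rewrite climb_off // /spine /=; apply: contra nb => /eqP[_ ->].
have climb_off_d d b i : d != d0 -> climb (Some (d, b, i)) = Some (d, b, i).
  by move=> nd; rewrite climb_off // /spine /=; apply: contra nd => /eqP[->].
(* The index [d] is changed at [b1], off the spine, where [climb] is the identity. *)
have move_level d b d' b' i :
    fixed (Some (d, b, i)) -> fixed (Some (d', b', i)).
  move/(move_b _ _ b1 _)/move_d => fd; apply: (move_b _ b1).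
  by apply: fd; apply: climb_off_b.
(* [K] lies in [B], so it fixes the point [a0] of the top fibre, on which [P true] is transitive;
   normality of [K] does the rest. *)
have fixed_top : fixed (Some (d0, b0, ord_max)).
  move=> x t xK; have [r rL /= tE] := atransP2 trL1 (in_setT a0) (in_setT t).
  have [g [y yU [yE g0]]] := lift_L1 rL.
  have yP : y ^ e^-1 \in P true by rewrite memJ_conjg.
  have : x ^ (y ^ e^-1)^-1 \in B.
    rewrite -P_cap; apply: subsetP sK _ _; rewrite memJ_norm // groupV nKG //.
    exact: subsetP (PG true) _ yP.
  rewrite -B_climb mem_conjgV => /MP[h [k [/dataP[+ _ _ _] xE]]].
  rewrite S1P => /andP[_ /eqP ha]; set w := _ ^ e in xE.
  have xew : x ^ e = w ^ y.
    rewrite /w -!conjgM; congr (x ^ _).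
    by rewrite conjgE invgK !invMg invgK !mulgA !mulgKV.
  apply: (@perm_inj _ e); rewrite -(permJ x) eE climb_max xew.
  have -> : (None, t) = y (None, a0) by rewrite yE g0 /= tE apermE.
  by rewrite permJ xE ha.
have fixed_level k (i : 'I_n.+1) :
    i + k = n -> forall d b, fixed (Some (d, b, i)).
  elim: k => [|k IHk] in i *; last rewrite addnS => ikn d b.
    rewrite addn0 => i_n d b; have -> : i = ord_max by apply: val_inj.
    exact: move_level fixed_top.
  have lt_i : (i.+1 < n.+1)%N by rewrite ltnS -[leqRHS]ikn ltnS leq_addr.
  (* [climb] fixes [(d1, b0, i.+1)] and sends [(d0, b0, i)] to [(d0, b0, i.+1)], so [move_d]
     descends one level. *)
  have /(_ d1 b0) fi := IHk (Ordinal lt_i) (etrans (addSn _ _) ikn).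
  apply: (move_level d0 b0); apply: move_d fi; first exact: climb_off_d.
  exact: climb_Some.
have fixed_all u : fixed u.
  case: u => [[[d b] i]|].
    by apply: (fixed_level (n - i)); rewrite subnKC // -ltnS.
  (* The last descent, from level 0 to [None]. *)
  have := @fixed_level n ord0 erefl d1 b0.
  apply: move_d; first exact: climb_off_d.
  exact: climb_None.
apply/trivgP/subsetP=> x xK; rewrite inE; apply/eqP/permP=> -[u t].
by rewrite perm1 fixed_all.
Qed.

Lemma twisted_amalgam (m : {perm T1}) :
    m \in N -> m != 1 -> m a0 = a0 ->
  exists (gT : finGroupType) (Q : bool -> {group gT}) phi psi,
    [/\ stab_rep (Q true) (Q false) L1 phi a0,
        stab_rep (Q false) (Q true) L2 psi b0,
        forall K : {group gT}, K <| Q true <*> Q false ->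
          K \subset Q true :&: Q false -> K :=: 1
      & (n < #|Q true :&: Q false|)%N].
Proof.
move=> mN m1 ma.
have inU1 x : x \in P true -> x ^ e \in U1 by rewrite mem_conjgV.
have sU1 x : x \in U1 -> x \in M L1 L2.
  by apply: subsetP (M_sub _ _) x; rewrite ?subxx.
have sU2 x : x \in U2 -> x \in M L1 L2.
  by apply: subsetP (M_sub _ _) x; rewrite ?subxx.
exists {perm point}, P, (fun x => phi1 (x ^ e)), phi2; split; last 1 first.
(* A copy of [m] on the one fibre over [(d0, b0, i)] lies in [B], since [m] is in [N] and fixes
   [a0]; the [n.+1] levels give distinct elements. *)
- pose g i (u : cell) := if u == Some (d0, b0, i) then m else 1.
  have g_ex i : exists x, x \in B /\ induces x (g i) 1.
    suff gP : data S1 S2 (g i) 1 by have [x xB xE] := M_ex sS1 gP; exists x.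
    apply/dataP; split=> [||u|d b j]; try exact: group1.
      by rewrite mem_rcoset invg1 mulg1 /g; case: eqP.
    rewrite /g perm1 repK; case: eqP => [[-> _ _] // | _].
    by rewrite perm1.
  have [f fP] := fin_all_exists g_ex.
  have f_inj : injective f.
    move=> i j fij; apply/eqP; apply: contraNT m1 => neq_ij.
    apply/eqP/permP=> t.
    have [[_ fi] [_ fj]] := (fP i, fP j).
    have /(congr1 snd) := fi (Some (d0, b0, i)) t; rewrite fij fj /=.
    rewrite /g eqxx perm1; case: eqP => [[ij]|_ <-]; last by rewrite perm1.
    by rewrite ij eqxx in neq_ij.
  rewrite P_cap; apply: (@leq_trans #|f @: [set: 'I_n.+1]|).
    by rewrite card_imset // cardsT card_ord.
  by apply: subset_leq_card; apply/subsetP=> _ /imsetP[i _ ->]; have [] := fP i.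
- split=> [x xP | x y xP yP | r rL | x xP].
  + exact: M_phi1 (inU1 x xP).
  + by rewrite conjMg (phiM _ _).1 // sU1 // inU1.
  + have [g [x xU [xE g0]]] := lift_L1 rL.
    by exists (x ^ e^-1); rewrite ?memJ_conjg // conjgKV (phi1E xE).
  (* By [B_climb], membership of [x] in [B] can be tested on [x ^ e], whose component at [None] is
     what the representation records. *)
  have -> : (x \in P false) = (x ^ e \in B).
    by rewrite -mem_conjgV B_climb -P_cap in_setI xP.
  apply/eqP/idP => [phia | xB]; last first.
    by have := M_phi1 xB; rewrite S1P => /andP[_ /eqP].
  case/MP: (inU1 x xP) phia => g [l [/dataP[g0 lL gN gc] xE]].
  rewrite (phi1E xE) => ga; apply/MP; exists g, l; split=> //.
  by apply/dataP; split=> //; rewrite S1P g0 ga eqxx.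
- split=> [x xP | x y xP yP | l lL | x xP].
  + exact: M_phi2 xP.
  + by rewrite (phiM _ _).2 // sU2.
  + by have [x xU xE] := lift_L2 lL; exists x => //; apply: phi2E xE.
  have -> : (x \in P true) = (x \in B) by rewrite -P_cap in_setI xP andbT.
  apply/eqP/idP => [phib | xB]; last first.
    by have := M_phi2 xB; rewrite S2P => /andP[_ /eqP].
  case/MP: xP phib => g [l [/dataP[g0 lL gN gc] xE]].
  rewrite (phi2E xE) => lb; apply/MP; exists g, l; split=> //.
  by apply/dataP; split=> //; rewrite S2P lL lb eqxx.
exact: core.
Qed.

End TwistedAmalgam.

(** * Unbounded edge stabilisers *)

Lemma non_semiprimitive_unbounded (T1 T2 : finType)
    (L1 N : {group {perm T1}}) (L2 : {group {perm T2}}) m a :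
    L2 :!=: 1 -> ptransitive L1 -> ptransitive L2 ->
    N <| L1 -> ~~ ptransitive N -> m \in N -> m != 1 -> m a = a ->
  ~ locally_restrictive L1 L2.
Proof.
move=> L2n1 trL1 trL2 nN ntrN mN m1 ma [c cP].
have [b1 [b0 neq_b]] : exists b1 b0 : T2, b1 != b0.
  have [l lL l1] := trivgPn _ L2n1.
  have /existsP[b nb] : [exists b, l b != b].
    apply: contraNT l1; rewrite negb_exists => /forallP lb.
    by apply/eqP/permP=> b; have := lb b; rewrite negbK perm1 => /eqP.
  by exists (l b), b.
pose D := {A : {set T1} | A \in orbit 'P N @: [set: T1]}.
have orbP t : orbit 'P N t \in orbit 'P N @: [set: T1] by apply: imset_f.
pose blk t : D := exist (fun A => A \in orbit 'P N @: [set: T1]) _ (orbP t).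
(* [rep] picks [a] in the orbit of [a], so that [m] fixes a base point. The default is never
   reached, orbits being nonempty. *)
pose rep (A : D) := if a \in val A then a else odflt a [pick t in val A].
have repK : cancel rep blk.
  move=> A; apply: val_inj => /=; have /imsetP[t _ At] := valP A.
  rewrite [RHS]At; apply/eqP; rewrite orbit_eq_mem -At /rep.
  case: ifP => // _; case: pickP => // /(_ t).
  by rewrite At orbit_refl.
have blkP s t : (blk s == blk t) = (s \in orbit 'P N t).
  by rewrite -val_eqE orbit_eq_mem.
have rep_a : rep (blk a) = a by rewrite /rep orbit_refl.
have [t tNa] : exists t, t \notin orbit 'P N a.
  apply/existsP; apply: contraR ntrN; rewrite negb_exists => /forallP inN.
  apply/imsetP; exists a => //; apply/setP=> t; rewrite inE.
  by have := inN t; rewrite negbK => ->.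
have neq_d : blk t != blk a by rewrite blkP.
(* The number of levels is tied to the supposed bound [c], which the order of the intersection then
   exceeds. *)
have [] := @twisted_amalgam _ _ _ _ _ _ rep blk _ _ _ _ c
    nN repK blkP neq_d neq_b trL1 trL2 m mN m1.
  by rewrite rep_a.
move=> gT [P [phi [psi [rep1 rep2 core big]]]].
have [Gamma [H [u [v [autH locH uv le]]]]] :=
  coset_graph trL1 trL2 rep1 rep2 core.
have := leq_trans big (leq_trans le (cP Gamma H autH locH u v uv)).
by rewrite ltnn.
Qed.

(** Reversing the witnessing edge swaps the two local actions, as befits a multiset. *)
Lemma locally_restrictiveC (T1 T2 : finType)
    (L1 : {group {perm T1}}) (L2 : {group {perm T2}}) :
  locally_restrictive L1 L2 -> locally_restrictive L2 L1.
Proof.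
case=> c cP; exists c => Gamma G autG [trG [u [v [uv Gu Gv]]]].
by apply: cP => //; split=> //; exists v, u; rewrite adj_sym.
Qed.

(** Proving [semiprimitive] hands over the normal subgroup directly, which a negated hypothesis
    would not do constructively. *)
Lemma locally_restrictive_semiprimitive (T1 T2 : finType)
    (L1 : {group {perm T1}}) (L2 : {group {perm T2}}) :
    L2 :!=: 1 -> ptransitive L1 -> ptransitive L2 ->
  locally_restrictive L1 L2 -> semiprimitive L1.
Proof.
move=> L2n1 trL1 trL2 restr N nN.
have [trN | ntrN] := boolP (ptransitive N); [by left | right=> g x gN gx].
apply/eqP/contraT=> g1.
by case: (non_semiprimitive_unbounded L2n1 trL1 trL2 nN ntrN gN g1 gx).
Qed.

Theorem theorem1p1 (T1 T2 : finType)
    (L1 : {group {perm T1}}) (L2 : {group {perm T2}}) :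
  L1 :!=: 1 -> L2 :!=: 1 -> ptransitive L1 -> ptransitive L2 ->
  ~ semiprimitive L1 \/ ~ semiprimitive L2 ->
  ~ locally_restrictive L1 L2.
Proof.
move=> L1n1 L2n1 trL1 trL2 nsp restr; case: nsp; apply.
  exact: locally_restrictive_semiprimitive restr.
exact: locally_restrictive_semiprimitive (locally_restrictiveC restr).
Qed.
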